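(* Let $m\ge 1$ be an integer, let $y\in\mathbb{C}^\times$, and let $G_m(x,y):=x^{-\frac m2}A_m(x,(-1)^{m-1}y)$. Then $G_m$ satisfies the following homogeneous $q$-difference equation of order $m+1$ in $x$: $$\left[\prod_{k=1}^{m}(T_x-q^{k-1})\right](T_x+x^my^{-1})G_m(x,y)=0.$$
   Context: Throughout $q\in\mathbb{C}^\times$ with $|q|<1$. $T_x$ is the $q$-shift operator $T_xf(x)=f(xq)$. The level $m$ Appell function is $$A_m(x,y):=x^{\frac m2}\sum_{n\in\mathbb{Z}}\frac{(-1)^{mn}y^nq^{\frac{mn(n+1)}{2}}}{1-xq^n}\qquad (x\in\mathbb{C}^\times\setminus q^{\mathbb{Z}}),$$ where the same branch of $x^{m/2}$ is used in $A_m$ and in the definition of $G_m$, so that the half-integer powers cancel and $G_m(x,y)$ is a single-valued meromorphic function of $x\in\mathbb{C}^\times$. *)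

(* Defs.v *)
From HB Require Import structures.
From mathcomp Require Export all_boot all_order all_algebra.
From mathcomp Require Export all_classical all_reals all_analysis.
From mathcomp Require Export complex.

Set Implicit Arguments.
Unset Strict Implicit.
Unset Printing Implicit Defensive.

Import Order.TTheory GRing.Theory Num.Theory.
Import numFieldNormedType.Exports.

Local Open Scope classical_set_scope.
Local Open Scope ring_scope.

(* Sum over all integers as the sum of its two one-sided series, which have to
   converge separately (Posz n = n, Negz n = - (n + 1)). *)
Definition zsum (C : numFieldType) (u : int -> C) : C :=
  limn (series (fun n : nat => u (Posz n))) +
  limn (series (fun n : nat => u (Negz n))).

(* A choice of square root at every nonzero point; the corresponding branch of
   z^(m/2) is z |-> (s z) ^+ m. No continuity is required, so every branch on
   every slit domain is covered. *)
Definition sqrt_branch (C : numFieldType) (s : C -> C) : Prop :=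
  forall z, z != 0 -> s z ^+ 2 = z.

(* The quotient (m n (n + 1)) / 2 is exact. *)
Definition appell (C : numFieldType) (s : C -> C) (q : C) (m : nat) (x y : C)
    : C :=
  s x ^+ m *
  zsum (fun n : int =>
    (-1) ^ (m%:Z * n) * y ^ n * q ^ ((m%:Z * n * (n + 1)) %/ 2)%Z
    / (1 - x * q ^ n)).

Definition appellG (C : numFieldType) (s : C -> C) (q : C) (m : nat) (y x : C)
    : C :=
  s x ^- m * appell s q m x ((-1) ^+ (m - 1) * y).

Definition qshift (C : numFieldType) (q : C) (f : C -> C) : C -> C :=
  fun x => f (x * q).

Definition mulop (C : numFieldType) (a : C -> C) (f : C -> C) : C -> C :=
  fun x => a x * f x.

(* Main.v *)
Require Import Defs.
From mathcomp Require Import ring.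

Set Implicit Arguments.
Unset Strict Implicit.
Unset Printing Implicit Defensive.

Import Order.TTheory GRing.Theory Num.Theory.
Import numFieldNormedType.Exports.
Local Open Scope classical_set_scope.
Local Open Scope ring_scope.

(* Write [c n = (-y)^n q^(m n (n+1)/2)], so that [G x = sum_n c n / (1 - x q^n)]
   and [c n = - y q^(m n) c (n-1)]. This recurrence gives
   [G (x q) + x^m y^-1 G x = sum_n c (n-1) (1 - (x q^n)^m) / (1 - x q^n)], which
   is a polynomial in [x] of degree less than [m]. Since [T_x - q^j] kills [x^j]
   and scales every other monomial, the product of the [T_x - q^j] for [j < m]
   annihilates it. Convergence holds because the ratios of consecutive terms
   decay geometrically in both directions. *)

(** * Bilateral series: linearity and shift of the index *)

Section BilateralSums.
Variable C : numFieldType.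
Implicit Types (u v : int -> C) (l k : C).

(** [limn] has a default value on divergent sequences, so [zsum] alone says nothing about
    convergence; this relation asserts that both halves converge. *)
Definition is_zsum u l : Prop :=
  exists a b : C, [/\ series (fun n : nat => u (Posz n)) @ \oo --> a,
    series (fun n : nat => u (Negz n)) @ \oo --> b & l = a + b].

Definition zsummable u : Prop := is_zsum u (zsum u).

Lemma is_zsumE u l : is_zsum u l -> zsum u = l.
Proof.
move=> [a [b [ha hb ->]]]; rewrite /zsum.
by congr (_ + _); apply: cvg_lim => //; exact: norm_hausdorff.
Qed.

Lemma zsummableP u :
  cvgn (series (fun n : nat => u (Posz n))) ->
  cvgn (series (fun n : nat => u (Negz n))) -> zsummable u.
Proof.
move=> ha hb; exists (limn (series (fun n : nat => u (Posz n)))).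
by exists (limn (series (fun n : nat => u (Negz n)))).
Qed.

Lemma is_zsum0 : is_zsum (fun=> 0) 0.
Proof.
have h : series (fun _ : nat => 0 : C) @ \oo --> (0 : C).
  rewrite (_ : series _ = cst 0); first exact: cvg_cst.
  by apply/funext => n; rewrite seriesEnat /= big1.
by exists 0, 0; split=> //; rewrite addr0.
Qed.

Lemma is_zsumD u v l k :
  is_zsum u l -> is_zsum v k -> is_zsum (fun n => u n + v n) (l + k).
Proof.
move=> [a [b [ha hb ->]]] [a' [b' [ha' hb' ->]]].
exists (a + a'), (b + b'); split; last by rewrite addrACA.
- by rewrite (_ : series _ = series (fun n : nat => u (Posz n))
     + series (fun n : nat => v (Posz n))); [exact: cvgD|rewrite -seriesD].
- by rewrite (_ : series _ = series (fun n : nat => u (Negz n))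
     + series (fun n : nat => v (Negz n))); [exact: cvgD|rewrite -seriesD].
Qed.

Lemma is_zsumM u l k : is_zsum u l -> is_zsum (fun n => k * u n) (k * l).
Proof.
move=> [a [b [ha hb ->]]]; exists (k * a), (k * b); rewrite mulrDr; split=> //.
- rewrite (_ : series _ = (fun n => k * series (fun n : nat => u (Posz n)) n)).
    by apply: cvgM => //; exact: cvg_cst.
  by apply/funext => n; rewrite !seriesEnat /= mulr_sumr.
- rewrite (_ : series _ = (fun n => k * series (fun n : nat => u (Negz n)) n)).
    by apply: cvgM => //; exact: cvg_cst.
  by apply/funext => n; rewrite !seriesEnat /= mulr_sumr.
Qed.

Lemma is_zsum_sum (I : Type) (r : seq I) (f : I -> int -> C) (g : I -> C) :
  (forall i, is_zsum (f i) (g i)) ->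
  is_zsum (fun n => \sum_(i <- r) f i n) (\sum_(i <- r) g i).
Proof.
move=> h; elim: r => [|i r IH].
  rewrite big_nil; have := is_zsum0; congr is_zsum.
  by apply/funext => n; rewrite big_nil.
rewrite big_cons; have := is_zsumD (h i) IH; congr is_zsum.
by apply/funext => n; rewrite big_cons.
Qed.

(** The shift moves the term of index -1 from the negative half to the other one, so the two limits
    change by opposite amounts. *)
Lemma is_zsum_pred u l : is_zsum u l -> is_zsum (fun n => u (n - 1)) l.
Proof.
move=> [a [b [ha hb ->]]]; exists (u (Negz 0) + a), (b - u (Negz 0)); split.
- rewrite -cvg_shiftS /=.
  rewrite (_ : (fun n => _) =
      (fun n => u (Negz 0) + series (fun n : nat => u (Posz n)) n)).
    by apply: cvgD => //; exact: cvg_cst.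
  apply/funext => n; rewrite !seriesEnat /= big_nat_recl //=.
  by congr (_ + _); apply: eq_bigr => i _; congr u; rewrite -addn1 PoszD addrK.
- rewrite (_ : series _ =
      (fun n => series (fun n : nat => u (Negz n)) n.+1 - u (Negz 0))).
    apply: cvgB; last exact: cvg_cst.
    by rewrite (cvg_shiftS (series (fun n : nat => u (Negz n)))).
  apply/funext => n; rewrite !seriesEnat /= big_nat_recl //= addrC addrA.
  rewrite addNr add0r; apply: eq_bigr => i _; congr u.
  by rewrite !NegzE -opprD -PoszD addn1.
- by ring.
Qed.

End BilateralSums.

(* Plays the role of completeness: [R[i]] has no [completeNormedModType]
   instance. *)
Definition geometric_cvg (C : numFieldType) : Prop :=
  forall (v : nat -> C) (M r : C), 0 <= r < 1 ->
    (forall n, `|v n| <= M * r ^+ n) -> cvgn (series v).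

(** * Convergence of theta-like series *)

Section SuperexponentialDecay.
Variable C : numFieldType.
Hypothesis hC : geometric_cvg C.

Lemma cvg_exprn0 (b : C) : `|b| < 1 -> (fun n : nat => b ^+ n) @ \oo --> (0 : C).
Proof.
move=> hb; apply: cvg_series_cvg_0; apply: (hC (M := 1) (r := `|b|)).
  by rewrite normr_ge0.
by move=> n; rewrite mul1r normrX.
Qed.

(** The terms before halving sets in are absorbed into the constant one at a time, by induction on
    [N]. *)
Lemma halving_geometric_bound (N : nat) (v : nat -> C) :
  (forall n, (N <= n)%N -> `|v n.+1| <= 2^-1 * `|v n|) ->
  exists2 M, 0 <= M & forall n, `|v n| <= M * 2^-1 ^+ n.
Proof.
elim: N v => [|N IH] v hv.
  exists `|v 0%N| => //; elim=> [|n IHn]; first by rewrite expr0 mulr1.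
  apply: le_trans (hv n isT) _; rewrite exprS mulrCA.
  by rewrite ler_wpM2l // invr_ge0.
have [n hn|M M0 hM] := IH (fun n => v n.+1); first exact: hv.
have h2 : 0 <= 2^-1 :> C by rewrite invr_ge0.
(* The factor 2 compensates for the index shift; the other summand covers the first term. *)
exists (`|v 0%N| + 2 * M); first by rewrite addr_ge0 // mulr_ge0.
case=> [|n]; first by rewrite expr0 mulr1 lerDl mulr_ge0.
apply: le_trans (hM n) _; rewrite mulrDl exprS mulrACA mulfV ?pnatr_eq0 //.
by rewrite mul1r lerDr mulr_ge0 // mulr_ge0 // exprn_ge0.
Qed.

(** The ratio [al * be ^+ n] tends to 0, so it is eventually at most 1/2 in norm and [v] has a
    geometric bound, which the bounded factor [b] preserves. *)
Lemma superexponential_cvg (al be B : C) (b v : nat -> C) : `|be| < 1 ->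
  (forall n, v n.+1 = al * be ^+ n * v n) ->
  (forall n, `|b n| <= B) -> cvgn (series (fun n => b n * v n)).
Proof.
move=> hbe hv hb.
have h0 : (fun n : nat => al * be ^+ n) @ \oo --> (0 : C).
  by rewrite -(mulr0 al); apply: cvgM (cvg_exprn0 hbe); exact: cvg_cst.
have h2 : 0 < 2^-1 :> C by rewrite invr_gt0.
have /cvgrPdist_le /(_ _ h2) [N _ hN] := h0.
have [n hn|M M0 hM] := @halving_geometric_bound N v.
  rewrite hv normrM ler_wpM2r //.
  by have := hN n hn; rewrite /= sub0r normrN.
apply: (hC (M := B * M) (r := 2^-1)).
  by rewrite ltW //= invf_lt1 // ltr1n.
by move=> n; rewrite normrM -mulrA ler_pM.
Qed.

Lemma cvg_bounded (b : nat -> C) (l : C) :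
  b @ \oo --> l -> exists B, forall n, `|b n| <= B.
Proof.
move=> hb; have /cvg_seq_bounded [M [Mr hM]] : cvgn b by apply/cvg_ex; exists l.
by exists (M + 1) => n; apply: hM => //; rewrite ltrDl.
Qed.

Lemma theta_zsummable (al be : C) (b d : int -> C) (l1 l2 : C) :
  al != 0 -> be != 0 -> `|be| < 1 ->
  (forall n : int, d (n + 1) = al * be ^ n * d n) ->
  (fun n : nat => b (Posz n)) @ \oo --> l1 ->
  (fun n : nat => b (Negz n)) @ \oo --> l2 ->
  zsummable (fun n => b n * d n).
Proof.
move=> al0 be0 hbe hd /cvg_bounded[B1 h1] /cvg_bounded[B2 h2].
apply: zsummableP.
  apply: (superexponential_cvg (al := al) (be := be) (B := B1)) => // n.
  by have := hd (Posz n); rewrite -PoszD addn1.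
(* The recurrence solved backwards from index -(n+1) to -(n+2) has ratio [al^-1 * be ^+ (n + 2)],
   which decays as well. *)
apply: (superexponential_cvg (al := al^-1 * be ^+ 2) (be := be) (B := B2)) => //.
move=> n; have -> : Negz n = Negz n.+1 + 1.
  by rewrite !NegzE -(addn1 n.+1) PoszD opprD addrNK.
rewrite hd NegzE -exprnN; set e := d _.
rewrite -[in RHS](addn2 n) exprD !mulrA.
have := expf_neq0 n be0; have := expf_neq0 2 be0.
set X := be ^+ 2; set Y := be ^+ n.
by move=> X0 Y0; rewrite -[LHS]mul1r; congr (_ * _); field; apply/and3P.
Qed.

End SuperexponentialDecay.

(** * Annihilation of polynomials by q-difference operators *)

Section QDifferenceOperators.
Variable C : numFieldType.
Implicit Types (q : C) (f : C -> C) (a : nat -> C).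

Lemma big_comp_rcons (T I : Type) (r : seq I) (i : I) (A : I -> T -> T) (f : T) :
  (\big[comp/id]_(j <- rcons r i) A j) f = (\big[comp/id]_(j <- r) A j) (A i f).
Proof.
elim: r => [|j r IH]; first by rewrite big_cons !big_nil.
by rewrite rcons_cons !big_cons /= IH.
Qed.

(** The innermost factor, of index m, acts first: it kills the top monomial and multiplies the
    coefficient of [z ^+ j] by a constant, so induction applies. The set [D] is there because the
    function is polynomial only away from the poles. *)
Lemma qdiff_poly_annihilated q (D : set C) (m : nat) a f :
  (forall z, D z -> D (z * q)) ->
  (forall z, D z -> f z = \sum_(j < m) a j * z ^+ j) ->
  forall z, D z ->
  (\big[comp/id]_(1 <= k < m.+1) (qshift q - mulop (fun=> q ^+ (k - 1)))) f z = 0.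
Proof.
move=> hD; elim: m a f => [|m IH] a f hf z Dz.
  by rewrite big_geq //= hf // big_ord0.
have -> : index_iota 1 m.+2 = rcons (index_iota 1 m.+1) m.+1.
  by have := iotaD 1 m 1; rewrite addn1 add1n cats1 /index_iota !subSS !subn0.
rewrite big_comp_rcons subn1; apply: (IH (fun j => a j * (q ^+ j - q ^+ m))) => //.
move=> w Dw.
rewrite -[LHS]/(f (w * q) - q ^+ m * f w) !hf //; last exact: hD.
rewrite mulr_sumr -sumrB big_ord_recr /= exprMn [X in _ + X](_ : _ = 0) ?addr0.
  by apply: eq_bigr => j _; rewrite exprMn; ring.
by ring.
Qed.

End QDifferenceOperators.

(** * The Appell series and its q-difference equation *)

Section AppellEquation.
Variables (C : numFieldType) (q y : C) (m : nat).
Hypotheses (hC : geometric_cvg C) (q0 : q != 0) (q1 : `|q| < 1).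
Hypotheses (m0 : (0 < m)%N) (y0 : y != 0).

Let c (n : int) : C := (-1) ^ (m%:Z * n) * ((-1) ^+ (m - 1) * y) ^ n
  * q ^ ((m%:Z * n * (n + 1)) %/ 2)%Z.

Let regular : set C := [set z | z != 0 /\ forall n : int, z != q ^ n].

Lemma appell_coefS (n : int) : c (n + 1) = - y * q ^+ m * (q ^+ m) ^ n * c n.
Proof.
have N10 : (-1 : C) != 0 by rewrite oppr_eq0 oner_eq0.
have Y0 : (-1) ^+ (m - 1) * y != 0 by rewrite mulf_neq0 // expf_neq0.
(* The increment of the numerator is a visible multiple of 2, so the integer quotient splits without
   a parity argument. *)
have e : m%:Z * (n + 1) * (n + 1 + 1)
    = m%:Z * (n + 1) * 2 + m%:Z * n * (n + 1).
  by ring.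
rewrite /c e divzMDl // expfzDr // mulrDr mulr1 !expfzDr // expr1z.
rewrite -(exprz_exp q) -!exprnP; set X := _ ^ _; set Y := _ ^ n; set Z := q ^ (_ %/ _)%Z.
(* The subtraction [m - 1] is truncated, hence the appeal to [m0]. *)
have -> : (-1 : C) ^+ m = - (-1) ^+ (m - 1).
  by rewrite -{1}(subnK m0) addn1 exprS mulN1r.
have : ((-1 : C) ^+ (m - 1)) ^+ 2 = 1.
  by rewrite -exprM mulnC exprM sqrrN expr1n expr1n.
set s := (-1) ^+ _ => hs; set V := q ^+ m; set W := V ^ _.
transitivity (- s ^+ 2 * (y * V * W * (X * Y * Z))); first by ring.
by rewrite hs; ring.
Qed.

Lemma regular_mulq z : regular z -> regular (z * q).
Proof.
move=> [z0 hz]; split=> [|n]; first exact: mulf_neq0.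
apply/eqP => e; have /eqP[] := hz (n - 1).
by rewrite expfzDr // -e mulfK.
Qed.

Lemma regular_denom z (n : int) : regular z -> 1 - z * q ^ n != 0.
Proof.
move=> [z0 hz]; rewrite subr_eq0; apply/eqP => e; have /eqP[] := hz (- n).
by rewrite -[LHS](mulfK (expfz_neq0 n q0)) -e mul1r invr_expz.
Qed.

(** The factors [(1 - z * q ^ n)^-1] tend to 1 as n goes to plus infinity and to 0 as n goes to
    minus infinity. *)
Lemma appell_summable z : regular z ->
  zsummable (fun n : int => (1 - z * q ^ n)^-1 * c n).
Proof.
move=> hz; have hqn := cvg_exprn0 hC q1.
apply: (theta_zsummable hC (al := - y * q ^+ m) (be := q ^+ m)
  (l1 := (1 - z * 0)^-1) (l2 := 0 * (0 - z)^-1)).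
- by rewrite mulf_neq0 ?oppr_eq0 // expf_neq0.
- by rewrite expf_neq0.
- by rewrite normrX exprn_ilt1 // -lt0n.
- exact: appell_coefS.
- apply: cvgV; first by rewrite mulr0 subr0 oner_eq0.
  apply: cvgB; first exact: cvg_cst.
  by apply: cvgM => //; exact: cvg_cst.
- have hqS : (fun n : nat => q ^+ n.+1) @ \oo --> (0 : C).
    by rewrite (cvg_shiftS (fun n : nat => q ^+ n)).
  (* Negative powers of [q] blow up, so the fraction is expanded by [q ^+ n.+1] before passing to
     the limit. *)
  rewrite (_ : (fun n : nat => _) = (fun n => q ^+ n.+1 * (q ^+ n.+1 - z)^-1)).
    apply: cvgM => //; apply: cvgV; first by rewrite sub0r oppr_eq0; case: hz.
    by apply: cvgB => //; exact: cvg_cst.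
  apply/funext => n; have := regular_denom (Negz n) hz.
  rewrite NegzE -exprnN; have := expf_neq0 n.+1 q0; set X := q ^+ n.+1 => X0 h.
  have h' : X - z != 0.
    by apply: contra_neq h => h; rewrite -[1](divff X0) -mulrBl h mul0r.
  by field; rewrite h' X0.
Qed.

Lemma appell_coef_summable (j : nat) :
  zsummable (fun n : int => c (n - 1) * (q ^ n) ^+ j).
Proof.
have -> : (fun n : int => c (n - 1) * (q ^ n) ^+ j)
    = (fun n => 1 * (c (n - 1) * (q ^ n) ^+ j)).
  by apply/funext => n; rewrite mul1r.
(* The factor [(q ^ n) ^+ j] only alters the constant [al] of the recurrence; [b] is constantly
   1. *)
apply: (theta_zsummable hC (al := - y * q ^+ j) (be := q ^+ m) (l1 := 1) (l2 := 1)).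
- by rewrite mulf_neq0 ?oppr_eq0 // expf_neq0.
- by rewrite expf_neq0.
- by rewrite normrX exprn_ilt1 // -lt0n.
- move=> n; rewrite addrK -{1}(subrK 1 n) appell_coefS !expfzDr ?expf_neq0 //.
  rewrite exprMn exprN1 expr1z; field.
  by rewrite expf_neq0.
- exact: cvg_cst.
- exact: cvg_cst.
Qed.

(** The branch cancels, since [s z] is nonzero when its square is. *)
Lemma appellGE (s : C -> C) (z : C) : sqrt_branch s -> z != 0 ->
  appellG s q m y z = zsum (fun n : int => (1 - z * q ^ n)^-1 * c n).
Proof.
move=> hs z0; rewrite /appellG /appell mulKf.
  by congr zsum; apply/funext => n; rewrite mulrC.
apply: expf_neq0; have := hs _ z0; apply: contra_eq_neq => ->.
by rewrite expr0n /= eq_sym.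
Qed.

(* Shifting the summation index in [G (z q)] makes the denominators agree, and
   the recurrence of [c] turns the numerator into [c (n-1) (1 - (z q^n)^m)]. *)
Lemma appellG_step (s : C -> C) (z : C) : sqrt_branch s -> regular z ->
  appellG s q m y (z * q) + z ^+ m * y^-1 * appellG s q m y z =
  \sum_(j < m) zsum (fun n : int => c (n - 1) * (q ^ n) ^+ j) * z ^+ j.
Proof.
move=> hs hz; have hzq := regular_mulq hz.
rewrite !appellGE //; [|by case: hz|by case: hzq].
have h1 := is_zsum_pred (appell_summable hzq).
have h2 := is_zsumM (z ^+ m * y^-1) (appell_summable hz).
rewrite -(is_zsumE (is_zsumD h1 h2)); apply: is_zsumE.
have := is_zsum_sum (index_enum 'I_m)
  (fun j : 'I_m => is_zsumM (z ^+ j) (appell_coef_summable j)).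
under [X in is_zsum _ X]eq_bigr do rewrite mulrC.
congr is_zsum; apply/funext => n.
have -> : c n = - y * (q ^ n) ^+ m * c (n - 1).
  rewrite -{1}(subrK 1 n) appell_coefS expfzDr ?expf_neq0 // exprN1.
  have -> : (q ^+ m) ^ n = (q ^ n) ^+ m by rewrite !exprnP !exprz_exp mulrC.
  by field; rewrite expf_neq0.
have -> : z * q * q ^ (n - 1) = z * q ^ n.
  by rewrite expfzDr // exprN1; field.
have := regular_denom n hz; set X := q ^ n; set cn := c _ => hX.
under eq_bigr => j _ do rewrite mulrCA -exprMn.
(* Finite geometric sum: it cancels the denominator and leaves a polynomial in [z]. *)
have e : (1 - z * X) * (\sum_(j < m) (z * X) ^+ j) = 1 - z ^+ m * X ^+ m.
  by rewrite -exprMn -opprB mulNr -subrX1 opprB.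
rewrite -mulr_sumr; apply: (mulfI hX); rewrite mulrCA e.
by field; rewrite hX y0.
Qed.

Lemma appellG_qdiff (s : C -> C) (z : C) : sqrt_branch s -> regular z ->
  ((\big[comp/id]_(1 <= k < m.+1) (qshift q - mulop (fun=> q ^+ (k - 1))))
   \o (qshift q + mulop (fun z => z ^+ m * y^-1))) (appellG s q m y) z = 0.
Proof.
move=> hs hz; apply: (qdiff_poly_annihilated
  (a := fun j => zsum (fun n : int => c (n - 1) * (q ^ n) ^+ j)) regular_mulq) => //.
by move=> w hw; exact: appellG_step.
Qed.

End AppellEquation.

(** * Geometric comparison over the complex numbers *)

Section ComplexSeries.
Variable R : realType.
Local Notation C := (R[i] : numFieldType).

Lemma real_geometric_cvg (v : nat -> R) (M r : R) : 0 <= r < 1 ->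
  (forall n, `|v n| <= M * r ^+ n) -> cvgn (series v).
Proof.
move=> /andP[r0 r1] hv; apply: normed_cvg.
apply: (series_le_cvg (v_ := geometric M r)) => [n|n|n|]; rewrite ?normr_ge0 //.
- by apply: le_trans (hv n).
- exact: hv.
- by apply: is_cvg_geometric_series; rewrite ger0_norm.
Qed.

Lemma cvg_real_complex (u : nat -> R) (l : R) :
  u @ \oo --> l -> (fun n => (u n)%:C%C : C) @ \oo --> (l%:C%C : C).
Proof.
move=> /cvgrPdist_lt hu; apply/cvgrPdist_lt => e e0.
(* In the order on [R[i]] a positive element is real, so [e] can be treated as a real number. *)
have er : e = (complex.Re e)%:C%C by rewrite RRe_real // gtr0_real.
have e0' : 0 < complex.Re e by rewrite er ltcR in e0.
near=> n; rewrite -rmorphB /= normc_def /= expr0n addr0 sqrtr_sqr er ltcR.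
by near: n; exact: hu.
Unshelve. all: by end_near. Qed.

(** Real and imaginary parts are dominated by the same real geometric series. *)
Lemma complex_geometric_cvg : geometric_cvg C.
Proof.
move=> v M r /andP[r0 r1] hv.
have rE : r = (complex.Re r)%:C%C by rewrite RRe_real // ger0_real.
have ME : M = (complex.Re M)%:C%C.
  rewrite RRe_real // ger0_real //; have := hv 0%N.
  by rewrite expr0 mulr1; apply: le_trans.
rewrite rE ler0c in r0; rewrite rE ltcR in r1.
have hRe n : `|complex.Re (v n)| <= complex.Re M * complex.Re r ^+ n.
  have := le_trans (normc_ge_Re (v n)) (hv n).
  by rewrite ME rE -rmorphXn -rmorphM lecR.
have hIm n : `|complex.Im (v n)| <= complex.Re M * complex.Re r ^+ n.
  (* Multiplication by ['i] preserves the norm and turns the imaginary part, up to sign, into the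
     real part. *)
  have := normc_ge_Re (v n * 'i%C); rewrite ReiNIm normrN normrM.
  rewrite (_ : `|'i%C| = 1 :> C) ?mulr1; last first.
    by rewrite normc_def /= expr0n expr1n add0r sqrtr1.
  move=> /le_trans /(_ (hv n)).
  by rewrite ME rE -rmorphXn -rmorphM lecR.
have r01 : 0 <= complex.Re r < 1 by rewrite r0.
have /cvg_ex[a ha] := real_geometric_cvg r01 hRe.
have /cvg_ex[b hb] := real_geometric_cvg r01 hIm.
apply/cvg_ex; exists (a%:C%C + 'i%C * b%:C%C : C).
rewrite (_ : series v = (fun n => (series (fun n => complex.Re (v n)) n)%:C%C
    + 'i%C * (series (fun n => complex.Im (v n)) n)%:C%C : C)).
  apply: cvgD; first exact: cvg_real_complex.
  by apply: cvgM; [exact: cvg_cst|exact: cvg_real_complex].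
apply/funext => n; rewrite !seriesEnat /= !rmorph_sum mulr_sumr -big_split /=.
by apply: eq_bigr => k _; exact: complexE.
Qed.

End ComplexSeries.

Theorem theorem2 (R : realType) (q : R[i]) (hq0 : q != 0) (hq1 : `|q| < 1)
    (m : nat) (hm : (1 <= m)%N) (y : R[i]) (hy : y != 0)
    (s : R[i] -> R[i]) (hs : sqrt_branch s)
    (x : R[i]) (hx0 : x != 0) (hxq : forall n : int, x != q ^ n) :
  ((\big[comp/id]_(1 <= k < m.+1) (qshift q - mulop (fun=> q ^+ (k - 1))))
   \o (qshift q + mulop (fun z => z ^+ m * y^-1)))
    (appellG s q m y) x = 0.
Proof.
exact: (appellG_qdiff (@complex_geometric_cvg R) hq0 hq1 hm hy hs (conj hx0 hxq)).
Qed.
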